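(* Let $G$ be a $D(0)$-group and suppose that $2\in\pi(G)$. Then $G$ is a finite group.
   Context: Groups may be finite or infinite. A $D(0)$-group is a group $G$ having no deficient non-trivial conjugacy class, where a non-trivial element $x\in G$ (and its conjugacy class) is called deficient if $\langle x\rangle$ is properly contained in $C_G(x)$. Thus $G$ is a $D(0)$-group if and only if $C_G(x)=\langle x\rangle$ for every $x\in G\setminus\{1\}$. $\pi(G)$ denotes the set of all primes dividing the (finite) order of some element of $G$. *)

(* Defs.v *)
(* [groupType] covers infinite groups; its [choiceType] component is no
   restriction, since classically every type carries one. *)
From mathcomp Require Import all_boot.
From mathcomp Require Import boolp classical_sets cardinality.

Set Implicit Arguments.
Unset Strict Implicit.
Unset Printing Implicit Defensive.

Local Open Scope group_scope.
Local Open Scope classical_set_scope.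

Definition cyclic_subgroup (G : groupType) (x : G) : set G :=
  [set y | exists k : nat, y = x ^+ k \/ y = x ^- k].

Definition centralizer (G : groupType) (x : G) : set G :=
  [set y | commute x y].

Definition conjugacy_class (G : groupType) (x : G) : set G :=
  [set x ^ g | g in [set: G]].

Definition deficient (G : groupType) (x : G) : Prop :=
  x <> 1 /\ cyclic_subgroup x `<` centralizer x.

Definition deficient_class (G : groupType) (K : set G) : Prop :=
  exists2 x : G, K = conjugacy_class x & deficient x.

Definition D0_group (G : groupType) : Prop :=
  ~ exists K : set G, deficient_class K.

(* Elements of infinite order have no order in this sense. *)
Definition has_order (G : groupType) (x : G) (n : nat) : Prop :=
  [/\ 0 < n, x ^+ n = 1 & forall m : nat, 0 < m -> x ^+ m = 1 -> n <= m].

Definition pi_group (G : groupType) : set nat :=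
  [set p | prime p /\ exists (x : G) (n : nat), has_order x n /\ p %| n].

Lemma cyclic_subgroup_sub (G : groupType) (x : G) :
  cyclic_subgroup x `<=` centralizer x.
Proof.
move=> y [k [->|->]]; rewrite /centralizer /=; first exact: commuteX.
exact/commuteV/commuteX.
Qed.

Lemma D0_groupP (G : groupType) :
  D0_group G <-> forall x : G, x <> 1 -> centralizer x = cyclic_subgroup x.
Proof.
split=> [D0 x x1|D0 [_ [x _ [x1 [_ ltx]]]]]; last by apply: ltx; rewrite D0.
apply/seteqP; split; last exact: cyclic_subgroup_sub.
apply: contrapT => nsub; apply: D0; exists (conjugacy_class x), x => //.
by split=> //; split=> //; exact: cyclic_subgroup_sub.
Qed.

(* Main.v *)
Require Import Defs.
From mathcomp Require Import all_boot.
From mathcomp Require Import classical_sets cardinality.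
From mathcomp Require Import boolp.

(** Call an element [t] with [t ^+ 2 = 1] and [t <> 1] an involution.  In a
    D(0)-group its centralizer is just [{1, t}], and two facts follow.

    First, every [x] with [x ^+ 2 <> 1] has odd order: [x] commutes with
    [x ^+ 2], hence is itself a power of [x ^+ 2] ([D0_odd_exponent]).  In
    particular there are no elements of infinite order.

    Second, every involution [t] inverts every [g] with [g ^+ 2 <> 1]
    ([D0_involution_inverts]).  Indeed [t] and [t ^ g] generate a dihedral
    group with rotation [c = t * t ^ g] of odd order, so a power [h] of [c],
    which [t] inverts, already satisfies [t ^ h = t ^ g]; as [g / h] then
    centralizes [t], it is [1] or [t], so [g] is [h] or [t * h].  The latter
    squares to [1].

    Now take an involution [t].  If all its conjugates equal [t], then [t] is
    central and the group is [{1, t}].  Otherwise let [s] be another conjugate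
    and [c = t * s]: any [y] with [y ^+ 2 <> 1] is inverted by both [t] and
    [s], so it commutes with [c] and lies in the finite group generated by
    [c].  If instead [y ^+ 2 = 1], then the same applies to [t * y], unless
    [y] commutes with [t].  So the group is the union of the cyclic group of
    [c] and its translate by [t]: it is dihedral. *)

Set Implicit Arguments.
Unset Strict Implicit.

Local Open Scope group_scope.
Local Open Scope classical_set_scope.

Lemma sq1_inv (G : groupType) (t : G) : t ^+ 2 = 1 -> t^-1 = t.
Proof. by rewrite expg2 => /mulg1_eq. Qed.

Lemma sq1_mulK (G : groupType) (t y : G) : t ^+ 2 = 1 -> t * (t * y) = y.
Proof. by rewrite mulgA -expg2 => ->; rewrite mul1g. Qed.

Lemma sq1_commute (G : groupType) (s t : G) :
  s ^+ 2 = 1 -> t ^+ 2 = 1 -> (s * t) ^+ 2 = 1 -> commute s t.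
Proof.
by move=> /sq1_inv s1 /sq1_inv t1 /sq1_inv; rewrite invgM s1 t1.
Qed.

Lemma finite_cyclic_subgroup (G : groupType) (x : G) (n : nat) :
  0 < n -> x ^+ n = 1 -> finite_set (cyclic_subgroup x).
Proof.
move=> n0 xn.
have modE k : x ^+ k = x ^+ (k %% n).
  by rewrite {1}(divn_eq k n) expgnDr mulnC expgnA xn expg1n mul1g.
pose pos := (fun k => x ^+ k) @` `I_n; pose neg := (fun k => x ^- k) @` `I_n.
apply: (@sub_finite_set _ _ (pos `|` neg)).
  by move=> y [k [->|->]]; [left|right]; exists (k %% n);
    rewrite /= ?ltn_pmod // -modE.
by rewrite finite_setU; split; apply: finite_image; exact: finite_II.
Qed.

Lemma D0_commute (G : groupType) (x y : G) :
  D0_group G -> x <> 1 -> commute x y -> cyclic_subgroup x y.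
Proof. by move=> /D0_groupP D0 /D0 <-. Qed.

Lemma D0_involution_commute (G : groupType) (t y : G) :
  D0_group G -> t <> 1 -> t ^+ 2 = 1 -> commute t y -> y = 1 \/ y = t.
Proof.
move=> hG t1 t2 /(D0_commute hG t1)[k].
have -> : t ^- k = t ^+ k by rewrite -expVgn sq1_inv.
have -> : t ^+ k = t ^+ odd k.
  by rewrite -{1}(odd_double_half k) expgnDr -mul2n expgnA t2 expg1n mulg1.
by case: (odd k) => -[] ->; [right|right|left|left].
Qed.

(** [x] is a power of [x ^+ 2], since it commutes with it. *)
Lemma D0_odd_exponent (G : groupType) (x : G) :
  D0_group G -> x ^+ 2 <> 1 -> exists m, x ^+ m.*2.+1 = 1.
Proof.
move=> hG x2; have cx : commute (x ^+ 2) x.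
  exact/commute_sym/commuteX/commute_refl.
have [k []] := D0_commute hG x2 cx; rewrite -expgnA mul2n.
- case: k => [x1|k]; first by case: x2; rewrite x1 expg1n.
  rewrite doubleS expgS -{1}[x]mulg1 => /mulgI xk.
  by exists k.
- by move=> xk; exists k; rewrite expgS {1}xk mulVg.
Qed.

Lemma D0_finite_cyclic_subgroup (G : groupType) (x : G) :
  D0_group G -> finite_set (cyclic_subgroup x).
Proof.
move=> hG; have [x2|x2] := pselect (x ^+ 2 = 1).
  exact: (@finite_cyclic_subgroup _ _ 2).
have [m xm] := D0_odd_exponent hG x2.
exact: (@finite_cyclic_subgroup _ _ m.*2.+1).
Qed.

(** The two reflections of a dihedral group are conjugate under a rotation
    when the rotation subgroup has odd order. *)
Lemma involution_conj_rotation (G : groupType) (s t : G) (m : nat) :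
    s ^+ 2 = 1 -> t ^+ 2 = 1 -> (t * s) ^+ m.*2.+1 = 1 ->
  exists2 h, h ^ t = h^-1 & t ^ h = s.
Proof.
move=> s2 t2 cm; set c := t * s in cm.
have ct n : (c ^+ n) ^ t = c ^- n.
  rewrite conjXg -expVgn; congr (_ ^+ n).
  by rewrite conjgE /c invgM !sq1_inv // -mulgA sq1_mulK.
(* [m.+1] inverts [2] modulo the odd exponent of [c]. *)
exists (c ^+ m.+1) => //.
have ht : c ^- m.+1 * t = t * c ^+ m.+1.
  by rewrite -ct conjgE sq1_inv // -!mulgA -expg2 t2 mulg1.
rewrite conjgE mulgA ht -mulgA -expgnDr addnn doubleS expgSr cm mul1g.
by rewrite /c sq1_mulK.
Qed.

Lemma D0_involution_inverts (G : groupType) (t g : G) :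
  D0_group G -> t <> 1 -> t ^+ 2 = 1 -> g ^+ 2 <> 1 -> g ^ t = g^-1.
Proof.
move=> hG t1 t2 g2.
have s2 : (t ^ g) ^+ 2 = 1 by rewrite -conjXg t2 conj1g.
have [m cm] : exists m, (t * t ^ g) ^+ m.*2.+1 = 1.
  have [c2|] := pselect ((t * t ^ g) ^+ 2 = 1); last exact: D0_odd_exponent.
  (* The two involutions then commute, so they coincide. *)
  have [/eqP|->] := D0_involution_commute hG t1 t2 (sq1_commute t2 s2 c2).
    by rewrite conjg_eq1 => /eqP.
  by exists 0; rewrite -expg2 t2.
have [h ht hs] := involution_conj_rotation s2 t2 cm.
have comm : commute t (g / h).
  apply/commgP; rewrite -conjg_fix conjgM -hs.
  by rewrite conjgK.
have [/divg1_eq -> //|/(congr1 (fun z => z * h))] :=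
  D0_involution_commute hG t1 t2 comm.
rewrite mulgVK => gE; case: g2; rewrite gE expg2.
have : t * h * t = h^-1 by rewrite -ht conjgE sq1_inv // !mulgA.
by rewrite mulgA => ->; rewrite mulVg.
Qed.

Lemma pi2_involution (G : groupType) :
  pi_group G 2 -> exists2 t : G, t <> 1 & t ^+ 2 = 1.
Proof.
move=> [_ [x [n [[n0 xn nmin] /dvdnP[k nE]]]]]; subst n.
exists (x ^+ k); last by rewrite -expgnA.
have k0 : 0 < k by move: n0; rewrite muln_gt0 => /andP[].
by move=> /(nmin _ k0); rewrite leqNgt ltn_Pmulr.
Qed.

Theorem theorem6 (G : groupType) (hG : D0_group G) (h2 : pi_group G 2) :
  finite_set [set: G].
Proof.
have [t t1 t2] := pi2_involution h2.
have [tC|/existsNP[g tg]] := pselect (forall g, t ^ g = t).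
  apply: (@sub_finite_set _ _ [set 1; t]); last exact: finite_set2.
  move=> y _; have cy : commute t y by apply/commgP; rewrite -conjg_fix tC.
  by have [->|->] := D0_involution_commute hG t1 t2 cy; [left|right].
set s := t ^ g in tg.
have s2 : s ^+ 2 = 1 by rewrite -conjXg t2 conj1g.
have s1 : s <> 1 by move/eqP; rewrite conjg_eq1 => /eqP.
have c1 : t * s <> 1 by move=> /mulg1_eq; rewrite sq1_inv // => /esym.
have inC y : y ^+ 2 <> 1 -> cyclic_subgroup (t * s) y.
  move=> y2; apply: D0_commute => //; apply/commute_sym/commgP.
  rewrite -conjg_fix conjgM (@D0_involution_inverts _ t) //.
  by rewrite conjVg (@D0_involution_inverts _ s) // invgK.
have C1 : cyclic_subgroup (t * s) 1 by exists 0; left.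
set C := cyclic_subgroup (t * s).
have finC : finite_set C by exact: D0_finite_cyclic_subgroup.
apply: (@sub_finite_set _ _ (C `|` (fun z => t * z) @` C)); last first.
  by rewrite finite_setU; split=> //; exact: finite_image.
move=> y _; have [y2|/inC] := pselect (y ^+ 2 = 1); last by left.
have [ty2|/inC Cty] := pselect ((t * y) ^+ 2 = 1); last first.
  by right; exists (t * y) => //; exact: sq1_mulK.
have cy := sq1_commute t2 y2 ty2.
have [->|->] := D0_involution_commute hG t1 t2 cy; first by left.
by right; exists 1; rewrite ?mulg1.
Qed.
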